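(* Let $X$ and $Y$ be random variables with probability density functions $f$ and $g$, respectively, let $\psi$ be a strictly monotonic, differentiable and invertible function, let $\omega(x)\ge0$ be a weight and $\beta\ge1$. Then $$R_\beta^\omega(\psi(X),\psi(Y))=\int_{\psi^{-1}(0)}^{\psi^{-1}(\infty)}\omega(\psi(x))f^\beta(x)g^{1-\beta}(x)\,dx\quad\text{if }\psi\text{ is strictly increasing,}$$ $$R_\beta^\omega(\psi(X),\psi(Y))=-\int_{\psi^{-1}(0)}^{\psi^{-1}(\infty)}\omega(\psi(x))f^\beta(x)g^{1-\beta}(x)\,dx\quad\text{if }\psi\text{ is strictly decreasing.}$$
   Context: For non-negative absolutely continuous random variables $X,Y$ with densities $f,g$, a measurable weight $\omega\ge0$ and $\beta\ge1$, the general weighted relative information generating function (GWRIGF) is $R_\beta^\omega(X,Y)=\int_0^\infty\omega(x)f^\beta(x)g^{1-\beta}(x)\,dx$. All of $X,Y,\psi(X),\psi(Y)$ are non-negative and absolutely continuous, and all integrals are assumed to exist. Densities are extended by $0$ outside the range of the variables, with the integrand taken to be $0$ where $f=0$. The function $\psi$ is a bijection from an open interval $J\subseteq\mathbb R$ onto $(0,\infty)$ with $X,Y\in J$ almost surely, and $\psi^{-1}(0)$, $\psi^{-1}(\infty)$ denote the limits (in $[-\infty,\infty]$) of $\psi^{-1}(u)$ as $u\to0^+$ and $u\to\infty$. The integral $\int_a^b$ with $a>b$ means $-\int_b^a$. *)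

(* Defs.v *)
From HB Require Import structures.
From mathcomp Require Import all_boot all_order all_algebra.
From mathcomp Require Import all_classical all_reals all_analysis.
Set Implicit Arguments.
Unset Strict Implicit.
Unset Printing Implicit Defensive.
Import Order.TTheory GRing.Theory Num.Theory.
Import numFieldNormedType.Exports.
Local Open Scope classical_set_scope.
Local Open Scope ring_scope.

(* [f] is a version of the density of [X]; the existence of such an [f] is the
   absolute continuity of [X]. *)
Definition has_density (d : measure_display) (T : measurableType d)
    (R : realType) (P : probability T R) (X : {RV P >-> R}) (f : R -> R) : Prop :=
  [/\ measurable_fun [set: R] f,
      forall x, 0 <= f x &
      forall A : set R, measurable A ->
        distribution P X A = (\int[lebesgue_measure]_(x in A) (f x)%:E)%E].

(* [powR] sets 0 `^ p = 0 for p < 0; here the value is +oo. *)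
Definition epow (R : realType) (a p : R) : \bar R :=
  if (a == 0) && (p < 0) then +oo%E else (a `^ p)%:E.

(* f^beta * g^(1 - beta), with value 0 where f = 0 (also if g = 0 there). *)
Definition relative_density (R : realType) (beta : R) (f g : R -> R) (x : R) :
    \bar R :=
  if f x == 0 then 0%E else ((f x `^ beta)%:E * epow (g x) (1 - beta))%E.

(* The GWRIGF of two variables with densities [f] and [g]. The integrand is
   nonnegative for nonnegative [w], [f], [g], so the integral always makes
   sense in \bar R. *)
Definition gwrigf (R : realType) (w : R -> R) (beta : R) (f g : R -> R) : \bar R :=
  (\int[lebesgue_measure]_(x in `]0%R, +oo[)
     ((w x)%:E * relative_density beta f g x))%E.

Definition oriented_integral (R : realType) (a b : \bar R) (F : R -> \bar R) :
    \bar R :=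
  if (a <= b)%E
  then (\int[lebesgue_measure]_(x in [set x : R | a < x%:E < b]) F x)%E
  else (- \int[lebesgue_measure]_(x in [set x : R | b < x%:E < a]) F x)%E.

(* psi^-1 for psi injective on [J]; the default 0 is used off psi(J) only. *)
Definition inv_on (R : realType) (J : set R) (psi : R -> R) : R -> R :=
  'pinv_(fun=> 0) J psi.

Definition inv_at0 (R : realType) (J : set R) (psi : R -> R) : \bar R :=
  lim ((inv_on J psi u)%:E @[u --> 0^'+]).

Definition inv_at_pinfty (R : realType) (J : set R) (psi : R -> R) : \bar R :=
  lim ((inv_on J psi u)%:E @[u --> +oo]).

(* Main.v *)
Require Import Defs.
From HB Require Import structures.
From mathcomp Require Import all_boot all_order all_algebra.
From mathcomp Require Import all_classical all_reals all_analysis.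
From mathcomp Require Import measurable_realfun.
Import Order.TTheory GRing.Theory Num.Theory.
Import numFieldNormedType.Exports.
Local Open Scope classical_set_scope.
Local Open Scope ring_scope.
Set Implicit Arguments.
Unset Strict Implicit.

(** The integrand f^beta g^(1 - beta) is homogeneous of degree 1 in (f, g), so
    its integral depends only on the two laws, not on the reference measure for
    which f and g are densities. Write U = psi(X) and V = psi(Y) with densities
    F and G. For every test function h >= 0, both
    int h f (G o psi) = E[h(X) G(U)] and int h (F o psi) g = E[h(Y) F(V)] equal
    int (h o psi^-1) F G, so f (G o psi) = (F o psi) g almost everywhere: the
    likelihood ratios f/g and (F/G) o psi agree. The two sides of the theorem
    are E[w(U) (F/G)^(beta - 1)(U)] and E[w(psi(X)) (f/g)^(beta - 1)(X)]. *)

(** * Laws with a density: null sets and expectations *)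

Section HasDensity.
Context (d : measure_display) (T : measurableType d) (R : realType)
  (P : probability T R).
Local Notation mu := (@lebesgue_measure R).
Local Open Scope ereal_scope.

Lemma distribution_null (X : {RV P >-> R}) (f : R -> R) (N : set R) :
  has_density X f -> measurable N -> mu N = 0 -> distribution P X N = 0.
Proof.
move=> [mf f0 Xf] mN N0; rewrite Xf//; apply: null_set_integral => //.
by apply/measurable_EFinP; exact: measurable_funTS.
Qed.

Lemma ae_has_density (X : {RV P >-> R}) (f : R -> R) (Q : R -> Prop) :
  has_density X f -> {ae mu, forall x, Q x} -> {ae P, forall t, Q (X t)}.
Proof.
move=> Xf [N [mN N0 QN]].
exists (X @^-1` N); split; last by move=> t /= /QN.
- by rewrite -[X in measurable X]setTI; exact: measurable_funPT.
- exact: (@distribution_null X f N Xf mN N0).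
Qed.

(** The law of [X] gives the zero set of [f] the mass of the integral of [f] over that set, which is
    0. This later permits division by [f (X t)]. *)
Lemma has_density_neq0 (X : {RV P >-> R}) (f : R -> R) :
  has_density X f -> {ae P, forall t, f (X t) != 0%R}.
Proof.
move=> [mf f0 Xf].
have mZ : measurable (f @^-1` [set 0%R]).
  by rewrite -[X in measurable X]setTI; exact: mf.
exists (X @^-1` (f @^-1` [set 0%R])); split.
- by rewrite -[X in measurable X]setTI; exact: measurable_funPT.
- rewrite -[LHS]/(distribution P X (f @^-1` [set 0%R])) Xf//.
  by apply: integral0_eq => x /= ->.
- by move=> t /= /negP; rewrite negbK => /eqP.
Qed.

Lemma integrable_has_density (X : {RV P >-> R}) (f : R -> R) :
  has_density X f -> mu.-integrable setT (EFin \o f).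
Proof.
move=> [mf f0 Xf]; apply/integrableP; split; first exact/measurable_EFinP.
under eq_integral do rewrite /= ger0_norm//.
by rewrite -Xf// probability_setT ltry.
Qed.

(** The law of [X] is absolutely continuous with respect to [mu], so integrals against it carry over
    to [mu] through the Radon-Nikodym derivative. That derivative equals [f] almost everywhere,
    because both have the same integral over every measurable set. *)
Lemma ge0_integral_has_density (X : {RV P >-> R}) (f : R -> R)
    (h : R -> \bar R) :
  has_density X f -> measurable_fun setT h -> (forall x, 0 <= h x) ->
  \int[P]_t h (X t) = \int[mu]_x (h x * (f x)%:E).
Proof.
move=> Xf mh h0; have := Xf; move=> [mf f0 XfE].
(* [lebesgue_measure] lives on [measurableTypeR R], whose display differs from
   the default one of [R]. *)
pose XR : T -> measurableTypeR R := X.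
have mXR : measurable_fun setT XR by exact: (@measurable_funPT _ _ _ _ X).
pose XM := isMeasurableFun.Build _ _ _ _ _ mXR.
pose XP : {RV P >-> measurableTypeR R} := HB.pack XR XM.
pose nu : {finite_measure set (measurableTypeR R) -> \bar R} :=
  distribution P XP.
have numu : nu `<< mu.
  move=> N muN A mA AN.
  exact: (@distribution_null X f A Xf mA (muN _ mA AN)).
transitivity (\int[nu]_x h x); first by rewrite ge0_integral_distribution.
rewrite -(Radon_Nikodym_SigmaFinite.change_of_variables numu)//.
have mRN : measurable_fun setT (Radon_Nikodym_SigmaFinite.f nu mu).
  exact: measurable_int (Radon_Nikodym_SigmaFinite.f_integrable numu).
apply: ae_eq_integral => //; [exact: emeasurable_funM| |].
  by apply: emeasurable_funM => //; exact/measurable_EFinP.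
have : ae_eq mu setT (EFin \o f) (Radon_Nikodym_SigmaFinite.f nu mu).
  apply: integral_ae_eq => //; first exact: integrable_has_density Xf.
  by move=> E _ mE; rewrite -Radon_Nikodym_SigmaFinite.f_integral// -XfE.
by apply: filterS => x /[apply] /= <-.
Qed.

End HasDensity.

(** * Powers of the likelihood ratio *)

(** This is (a / b)^(beta - 1), with value +oo when [b] is 0, [a] is positive and [beta] exceeds
    1. *)
Definition ratio_power (R : realType) (beta a b : R) : \bar R :=
  ((a `^ (beta - 1))%:E * epow b (1 - beta))%E.

Lemma epow_ge0 (R : realType) (a p : R) : (0 <= epow a p)%E.
Proof. by rewrite /epow; case: ifP; rewrite ?leey// lee_fin powR_ge0. Qed.

Lemma ratio_power_ge0 (R : realType) (beta a b : R) :
  (0 <= ratio_power beta a b)%E.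
Proof. by rewrite mule_ge0 ?epow_ge0// lee_fin powR_ge0. Qed.

Lemma measurable_epow (R : realType) (p : R) :
  measurable_fun [set: R] (fun a => epow a p).
Proof.
apply: measurable_fun_ifT => //; last first.
  by apply/measurable_EFinP; exact: measurable_powR.
by apply: measurable_and => //; exact: measurable_fun_eqr.
Qed.

Lemma measurable_ratio_power (d : measure_display) (T : measurableType d)
    (R : realType) (beta : R) (f g : T -> R) :
  measurable_fun setT f -> measurable_fun setT g ->
  measurable_fun setT (fun x => ratio_power beta (f x) (g x)).
Proof.
move=> mf mg; apply: emeasurable_funM.
  by apply/measurable_EFinP; exact: (measurableT_comp (measurable_powR _)).
exact: (measurableT_comp (measurable_epow _)).
Qed.

(** Splitting off one factor [f] turns the integral into an expectation under the law with density
    [f]. Where [f] vanishes, the product is 0 even if the ratio is infinite. *)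
Lemma relative_densityE (R : realType) (beta : R) (f g : R -> R) (x : R) :
  1 <= beta -> 0 <= f x ->
  relative_density beta f g x =
    (ratio_power beta (f x) (g x) * (f x)%:E)%E.
Proof.
move=> beta1 fx0; rewrite /relative_density /ratio_power.
case: eqP => [->|_]; first by rewrite mule0.
by rewrite muleAC -EFinM mulrC mulr_powRB1// (lt_le_trans ltr01).
Qed.

(** The hypothesis is a / b = A / B in cross-multiplied form, which still makes sense for zero
    denominators and forces [b] and [B] to vanish together. *)
Lemma ratio_power_scale (R : realType) (beta a b A B : R) :
  0 < a -> 0 < A -> 0 <= b -> 0 <= B -> a * B = A * b ->
  ratio_power beta a b = ratio_power beta A B.
Proof.
move=> a0 A0 b0 B0 aB; rewrite /ratio_power.
have B0E : (B == 0) = (b == 0).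
  have := congr1 (eq_op ^~ 0) aB.
  by rewrite /= !mulf_eq0 (gt_eqF a0) (gt_eqF A0).
rewrite /epow B0E; have [bE|bN0] := eqVneq b 0 => /=.
  have BE : B = 0 by apply/eqP; rewrite B0E bE.
  (* With both denominators 0, the two sides are +oo for [beta] above 1, 1 for [beta] equal to 1,
     and 0 below. *)
  rewrite BE bE; case: ltP => beta1.
    by rewrite !gt0_muley// lte_fin powR_gt0.
  have [->|beta_neq1] := eqVneq beta 1; first by rewrite subrr !powRr0.
  by rewrite powR0 ?mule0// subr_eq0 eq_sym.
have bp : 0 < b by rewrite lt_def bN0.
have Bp : 0 < B by rewrite lt_def B0E bN0.
rewrite -!EFinM -(opprB beta 1) !powRN; congr (_%:E).
have := congr1 (fun x => x `^ (beta - 1)) aB.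
rewrite /= !powRM ?ltW// => E.
by apply/eqP; rewrite eqr_div ?lt0r_neq0 ?powR_gt0// E.
Qed.

(** * Invariance under an almost surely invertible map [s] with inverse [r] *)

Section InvariantTransform.
Context (d : measure_display) (T : measurableType d) (R : realType)
  (P : probability T R).
Local Notation mu := (@lebesgue_measure R).
Local Open Scope ereal_scope.
Context (X Y U V : {RV P >-> R}) (f g F G s r : R -> R).
Context (Xf : has_density X f) (Yg : has_density Y g).
Context (UF : has_density U F) (VG : has_density V G).
Context (ms : measurable_fun setT s) (mr : measurable_fun setT r).
Context (Us : {ae P, forall t, U t = s (X t)}).
Context (Xr : {ae P, forall t, X t = r (U t)}).
Context (Vs : {ae P, forall t, V t = s (Y t)}).
Context (Yr : {ae P, forall t, Y t = r (V t)}).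

Lemma measurable_fun_RV (h : R -> \bar R) (Z : {RV P >-> R}) :
  measurable_fun setT h -> measurable_fun setT (fun t => h (Z t)).
Proof.
by move=> mh; exact: (measurableT_comp mh (@measurable_funPT _ _ _ _ Z)).
Qed.

Lemma integral_cross_density (h : R -> \bar R) :
  measurable_fun setT h -> (forall x, 0 <= h x) ->
  \int[mu]_x (h x * (f x * G (s x))%:E) =
  \int[mu]_x (h x * (F (s x) * g x)%:E).
Proof.
move=> mh h0.
have [mf f0 _] := Xf; have [mg g0 _] := Yg.
have [mF F0 _] := UF; have [mG G0 _] := VG.
(* Both integrals are E[h(Z) K(W)], computed once from the law of [Z] and once from that of [W]. For
   ([X], [U]) with [K] = [G] and for ([Y], [V]) with [K] = [F], the right-hand sides differ only in
   the order of [F] and [G]. *)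
have step (Z W : {RV P >-> R}) (k l K : R -> R) :
    has_density Z k -> has_density W l ->
    measurable_fun setT K -> (forall x, (0 <= K x)%R) ->
    {ae P, forall t, W t = s (Z t)} -> {ae P, forall t, Z t = r (W t)} ->
    \int[mu]_x (h x * (k x * K (s x))%:E) =
    \int[mu]_u (h (r u) * (K u)%:E * (l u)%:E).
  move=> Zk Wl mK K0 Ws Zr; have mEK := (measurable_EFinP _ K).2 mK.
  have mh1 : measurable_fun setT (fun x => h x * (K (s x))%:E).
    by apply: emeasurable_funM => //; exact: (measurableT_comp mEK ms).
  have mh2 : measurable_fun setT (fun u => h (r u) * (K u)%:E).
    by apply: emeasurable_funM => //; exact: (measurableT_comp mh mr).
  have pos1 x : 0 <= h x * (K (s x))%:E by rewrite mule_ge0 ?lee_fin.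
  have pos2 u : 0 <= h (r u) * (K u)%:E by rewrite mule_ge0 ?lee_fin.
  rewrite -[RHS](ge0_integral_has_density Wl mh2 pos2).
  under eq_integral do rewrite mulrC EFinM muleA.
  rewrite -[LHS](ge0_integral_has_density Zk mh1 pos1).
  apply: ge0_ae_eq_integral => //.
  - exact: (measurable_fun_RV Z mh1).
  - exact: (measurable_fun_RV W mh2).
  - by apply: filterS2 Ws Zr => t -> <- _.
rewrite (step X U f F G)//.
under [RHS]eq_integral do rewrite mulrC.
rewrite (step Y V g G F)//; apply: eq_integral => u _.
by rewrite muleAC.
Qed.

(* Weighting by [1 / ((1 + F o s) (1 + G o s))] makes both sides integrable. *)
Lemma cross_density_ae : {ae mu, forall x, (f x * G (s x) = F (s x) * g x)%R}.
Proof.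
have [mf f0 _] := Xf; have [mg g0 _] := Yg.
have [mF F0 _] := UF; have [mG G0 _] := VG.
have mFs : measurable_fun setT (F \o s) := measurableT_comp mF ms.
have mGs : measurable_fun setT (G \o s) := measurableT_comp mG ms.
pose c x : R := (((1 + F (s x)) * (1 + G (s x))) `^ (-1))%R.
have Fp x : (0 < 1 + F (s x))%R by rewrite ltr_wpDr.
have Gp x : (0 < 1 + G (s x))%R by rewrite ltr_wpDr.
have c0 x : (0 < c x)%R by rewrite powR_gt0 ?mulr_gt0.
have mc : measurable_fun setT c.
  apply: (measurableT_comp (measurable_powR (-1))).
  by apply: measurable_funM; exact: measurable_funD.
have mL : measurable_fun setT (fun x : R => (c x * (f x * G (s x)))%:E).
  apply/measurable_EFinP; apply: measurable_funM => //.
  exact: measurable_funM.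
have mR : measurable_fun setT (fun x : R => (c x * (F (s x) * g x))%:E).
  apply/measurable_EFinP; apply: measurable_funM => //.
  exact: measurable_funM.
(* The function is dominated by [f], since G(s x) <= 1 + G(s x) <= (1 + F(s x)) (1 + G(s x)). *)
have intL : mu.-integrable setT (fun x => (c x * (f x * G (s x)))%:E).
  apply: le_integrable (integrable_has_density Xf) => //.
  move=> x _; rewrite lee_fin !ger0_norm//; last by rewrite !mulr_ge0// ltW.
  rewrite mulrCA ler_piMr// /c powR_inv1; last by rewrite ltW// mulr_gt0.
  rewrite mulrC ler_pdivrMr ?mulr_gt0// mul1r.
  rewrite (le_trans (_ : _ <= 1 + G (s x))%R) ?lerDr//.
  by rewrite ler_peMl ?lerDl// ltW.
have : ae_eq mu setT (fun x => (c x * (f x * G (s x)))%:E)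
                     (fun x => (c x * (F (s x) * g x))%:E).
  apply: integral_ae_eq => // E _ mE.
  (* This test function turns equality of the integrals over [E] into an instance of
     [integral_cross_density]. *)
  pose h (x : R) : \bar R := (c x * \1_E x)%:E.
  have mh : measurable_fun setT h.
    by apply/measurable_EFinP; apply: measurable_funM.
  rewrite integral_mkcond [RHS]integral_mkcond.
  transitivity (\int[mu]_x (h x * (f x * G (s x))%:E)).
    apply: eq_integral => x _; rewrite patchE /h indicE.
    by case: ifP => _; rewrite ?mulr1// mulr0 mul0e.
  rewrite (integral_cross_density mh) => [|x]; last first.
    by rewrite lee_fin mulr_ge0// ltW.
  apply: eq_integral => x _; rewrite patchE /h indicE.
  by case: ifP => _; rewrite ?mulr1// mulr0 mul0e.
by apply: filterS => x /(_ I)[] /mulfI; apply; rewrite gt_eqF.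
Qed.

Lemma integral_relative_density_transform (beta : R) (w : R -> \bar R) :
  (1 <= beta)%R -> measurable_fun setT w -> (forall u, 0 <= w u) ->
  \int[mu]_u (w u * relative_density beta F G u) =
  \int[mu]_x (w (s x) * relative_density beta f g x).
Proof.
move=> beta1 mw w0.
have [mf f0 _] := Xf; have [mg g0 _] := Yg.
have [mF F0 _] := UF; have [mG G0 _] := VG.
under eq_integral do rewrite relative_densityE// muleA.
under [RHS]eq_integral do rewrite relative_densityE// muleA.
have mL : measurable_fun setT (fun u => w u * ratio_power beta (F u) (G u)).
  by apply: emeasurable_funM => //; exact: measurable_ratio_power.
have mR : measurable_fun setT
    (fun x => w (s x) * ratio_power beta (f x) (g x)).
  apply: emeasurable_funM; first exact: (measurableT_comp mw ms).
  exact: measurable_ratio_power.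
have L0 u : 0 <= w u * ratio_power beta (F u) (G u).
  by rewrite mule_ge0// ratio_power_ge0.
have R0 x : 0 <= w (s x) * ratio_power beta (f x) (g x).
  by rewrite mule_ge0// ratio_power_ge0.
rewrite -[LHS](ge0_integral_has_density UF mL L0).
rewrite -[RHS](ge0_integral_has_density Xf mR R0).
apply: ge0_ae_eq_integral => //.
- exact: (measurable_fun_RV U mL).
- exact: (measurable_fun_RV X mR).
(* Almost surely both numerators are positive, so the cross-multiplied identity at [X t] gives equal
   ratio powers. *)
have fF0 : {ae P, forall t, (f (X t) != 0)%R /\ (F (U t) != 0)%R}.
  by apply: filterS2 (has_density_neq0 Xf) (has_density_neq0 UF).
apply: filterS3 fF0 Us (ae_has_density Xf cross_density_ae).
move=> t [fX0 FU0] UX fGX _.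
rewrite UX in FU0 *; congr (_ * _); apply/esym.
by apply: ratio_power_scale => //; rewrite lt_def ?fX0 ?FU0 /=.
Qed.

End InvariantTransform.

(** * Monotone functions on an interval, and endpoints of open intervals *)

(** Preimages of upper rays within [D] are intervals, hence measurable, and such rays generate the
    Borel sets. *)
Lemma measurable_fun_nondecreasing_in (R : realType) (D : set R) (f : R -> R) :
  is_interval D -> {in D &, {homo f : x y / x <= y}} -> measurable_fun D f.
Proof.
move=> itvD ndf.
apply: (measurability (@RGenCInfty.G R)) => [|/= _ [_] [c] -> <-].
  exact: RGenCInfty.measurableE.
apply: is_interval_measurable => x y/=.
rewrite !in_itv/= !andbT => -[Dx cx] [Dy cy] z /andP[xz zy].
have Dz : D z by apply: (itvD x y); rewrite ?xz.
by split => //; rewrite in_itv/= andbT (le_trans cx)// ndf// inE.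
Qed.

Lemma measurable_fun_nonincreasing_in (R : realType) (D : set R) (f : R -> R) :
  is_interval D -> {in D &, {homo f : x y /~ x <= y}} -> measurable_fun D f.
Proof.
move=> itvD nif; rewrite -(opprK f); apply/measurable_funN.
apply: measurable_fun_nondecreasing_in => // x y Dx Dy xy.
by rewrite lerN2 nif.
Qed.

(** Replacing [f] by -oo up to [a] makes it monotone on the whole line and changes neither the
    supremum nor the limit. *)
Lemma cvgey_nondecreasing_in (R : realType) (a : R) (f : R -> \bar R) :
  {in `]a, +oo[ &, nondecreasing_fun f} ->
  f x @[x --> +oo] --> ereal_sup (f @` `]a, +oo[).
Proof.
move=> ndf; pose f' x := if a < x then f x else -oo%E.
have ndf' : {homo f' : x y / x <= y >-> (x <= y)%E}.
  move=> x y xy; rewrite /f'; case: ifPn => [ax|_]; last exact: leNye.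
  by rewrite (lt_le_trans ax xy) ndf// in_itv/= andbT// (lt_le_trans ax xy).
have -> : ereal_sup (f @` `]a, +oo[) = ereal_sup (range f').
  apply/eqP; rewrite eq_le; apply/andP; split.
    apply: ge_ereal_sup => _ [x /= ax <-]; apply: ereal_sup_ubound.
    by exists x => //; rewrite /f'; move: ax; rewrite in_itv/= andbT => ->.
  apply: ge_ereal_sup => _ [x _ <-]; rewrite /f'; case: ifPn => [ax|_ ].
    by apply: ereal_sup_ubound; exists x => //=; rewrite in_itv/= andbT.
  exact: leNye.
apply: cvg_trans (nondecreasing_cvge ndf').
apply: near_eq_cvg; near=> x; rewrite /f' ifT//.
by near: x; apply: nbhs_pinfty_gt; exact: num_real.
Unshelve. all: by end_near. Qed.

Lemma cvgey_nonincreasing_in (R : realType) (a : R) (f : R -> \bar R) :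
  {in `]a, +oo[ &, nonincreasing_fun f} ->
  f x @[x --> +oo] --> ereal_inf (f @` `]a, +oo[).
Proof.
move=> nif; rewrite -cvgeNP /ereal_inf oppeK image_comp.
by apply: cvgey_nondecreasing_in => x y ax ay xy; rewrite leeN2 nif.
Qed.

(** An open set contains neither its infimum nor its supremum. This identifies the domain of
    [oriented_integral] with [J]. *)
Lemma open_interval_ereal_inf_sup (R : realType) (J : set R) :
  open J -> is_interval J ->
  [set x | (ereal_inf (EFin @` J) < x%:E < ereal_sup (EFin @` J))%E] = J.
Proof.
move=> oJ iJ; apply/seteqP; split => x /=.
  move=> /andP[/ereal_inf_lt[_ [y Jy <-]]]; rewrite lte_fin => yx.
  move=> /ereal_sup_gt[_ [z Jz <-]]; rewrite lte_fin => xz.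
  by apply: (iJ y z) => //; rewrite !ltW.
move=> Jx; have /nbhs_ballP[e /= e0 xeJ] : nbhs x J by exact: open_nbhs_nbhs.
have Jxl : J (x - e / 2).
  apply: xeJ; rewrite /ball/= opprB addrC subrK gtr0_norm ?divr_gt0//.
  by rewrite ltr_pdivrMr// ltr_pMr// ltr1n.
have Jxr : J (x + e / 2).
  apply: xeJ; rewrite /ball/= opprD addNKr normrN gtr0_norm ?divr_gt0//.
  by rewrite ltr_pdivrMr// ltr_pMr// ltr1n.
apply/andP; split.
  apply: (@le_lt_trans _ _ (x - e / 2)%:E); last first.
    by rewrite lte_fin ltrBlDr ltrDl divr_gt0.
  by apply: ereal_inf_lbound; exists (x - e / 2).
apply: (@lt_le_trans _ _ (x + e / 2)%:E).
  by rewrite lte_fin ltrDl divr_gt0.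
by apply: ereal_sup_ubound; exists (x + e / 2).
Qed.

(** * The inverse of [psi] and its limits at 0 and at infinity *)

Section Inverse.
Context (R : realType) (J : set R) (psi : R -> R).
Context (psi_bij : set_bij J `]0, +oo[ psi).
Local Notation phi := (inv_on J psi).

Lemma inv_onK : {in `]0, +oo[, cancel phi psi}.
Proof.
have [_ _ surj] := psi_bij.
by move=> u u0; apply: (surjpK _ surj); rewrite inE.
Qed.

Lemma inv_on_mem u : 0 < u -> J (phi u).
Proof.
have [_ _ surj] := psi_bij => u0.
apply: (surjpinv_image_sub (dflt := fun=> 0) surj).
by exists u => //=; rewrite in_itv/= u0.
Qed.

Lemma psi_gt0 x : J x -> 0 < psi x.
Proof. by have [+ _ _] := psi_bij => /[apply] /=; rewrite in_itv/= andbT. Qed.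

Lemma inv_on_psi x : J x -> phi (psi x) = x.
Proof.
by have [_ inj _] := psi_bij => Jx; apply: pinvKV => //; rewrite inE.
Qed.

Lemma image_inv_on : (EFin \o phi) @` `]0, +oo[ = EFin @` J.
Proof.
apply/seteqP; split => _ [x Jx <-].
  exists (phi x) => //; apply: inv_on_mem; move: Jx.
  by rewrite /= in_itv/= andbT.
by exists (psi x); rewrite /= ?in_itv/= ?psi_gt0// inv_on_psi.
Qed.

Lemma nondecreasing_inv_on : {in J &, {homo psi : x y / x < y}} ->
  {in `]0, +oo[ &, {homo phi : x y / x <= y}}.
Proof.
move=> inc x y; rewrite !in_itv/= !andbT => x0 y0 xy.
rewrite leNgt; apply/negP => /inc; rewrite !inE.
move=> /(_ (inv_on_mem y0) (inv_on_mem x0)).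
by rewrite !inv_onK ?in_itv/= ?x0 ?y0// ltNge xy.
Qed.

Lemma nonincreasing_inv_on : {in J &, {homo psi : x y /~ x < y}} ->
  {in `]0, +oo[ &, {homo phi : x y /~ x <= y}}.
Proof.
move=> dec x y; rewrite !in_itv/= !andbT => x0 y0 xy.
rewrite leNgt; apply/negP => /dec; rewrite !inE.
move=> /(_ (inv_on_mem x0) (inv_on_mem y0)).
by rewrite !inv_onK ?in_itv/= ?x0 ?y0// ltNge xy.
Qed.

(** One-sided limits of a monotone function are extrema of its values, and the values of the inverse
    on the positive half-line fill [J]. *)
Lemma inv_lim_increasing : {in J &, {homo psi : x y / x < y}} ->
  inv_at0 J psi = ereal_inf (EFin @` J) /\
  inv_at_pinfty J psi = ereal_sup (EFin @` J).
Proof.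
move=> /nondecreasing_inv_on nd.
rewrite -image_inv_on; split; apply/cvg_lim => //.
  by apply: nondecreasing_at_right_cvge => // x y x0 y0 xy; rewrite lee_fin nd.
by apply: cvgey_nondecreasing_in => // x y x0 y0 xy; rewrite lee_fin nd.
Qed.

Lemma inv_lim_decreasing : {in J &, {homo psi : x y /~ x < y}} ->
  inv_at0 J psi = ereal_sup (EFin @` J) /\
  inv_at_pinfty J psi = ereal_inf (EFin @` J).
Proof.
move=> /nonincreasing_inv_on ni.
rewrite -image_inv_on; split; apply/cvg_lim => //.
  by apply: nonincreasing_at_right_cvge => // x y x0 y0 xy; rewrite lee_fin ni.
by apply: cvgey_nonincreasing_in => // x y x0 y0 xy; rewrite lee_fin ni.
Qed.

End Inverse.

(** * Change of variables for the GWRIGF, and the two monotone cases *)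

(** The direction of monotonicity does not enter here, so one unsigned formula over [J] serves both
    cases. *)
Lemma gwrigf_transform (d : measure_display) (T : measurableType d)
    (R : realType) (P : probability T R) (X Y psiX psiY : {RV P >-> R})
    (f g fpsi gpsi : R -> R) (J : set R) (psi w : R -> R) (beta : R) :
  has_density X f -> has_density Y g -> measurable J ->
  {ae P, forall t, J (X t)} -> {ae P, forall t, J (Y t)} ->
  set_bij J `]0, +oo[ psi ->
  measurable_fun J psi -> measurable_fun (`]0, +oo[ : set R) (inv_on J psi) ->
  {ae P, forall t, psiX t = psi (X t)} ->
  {ae P, forall t, psiY t = psi (Y t)} ->
  has_density psiX fpsi -> has_density psiY gpsi ->
  measurable_fun (`]0, +oo[ : set R) w -> (forall x, 0 < x -> 0 <= w x) ->
  1 <= beta ->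
  gwrigf w beta fpsi gpsi =
  (\int[lebesgue_measure]_(x in J)
     ((w (psi x))%:E * relative_density beta f g x))%E.
Proof.
move=> Xf Yg mJ XJ YJ bij mpsi minv Xpsi Ypsi psiXf psiYg mw w0 beta1.
have mD : measurable (`]0, +oo[ : set R) by exact: measurable_itv.
(* Extension by 0 gives measurable functions on the whole line; [s] and [r] remain inverse to each
   other along the variables almost surely. *)
pose s := psi \_ J; pose r := inv_on J psi \_ `]0, +oo[.
pose w1 := (EFin \o w) \_ `]0, +oo[.
have ms : measurable_fun setT s by apply/(measurable_restrictT _ mJ).
have mr : measurable_fun setT r by apply/(measurable_restrictT _ mD).
have mw1 : measurable_fun setT w1.
  by apply/(measurable_restrictT _ mD)/measurable_EFinP.
have w1_ge0 u : (0 <= w1 u)%E.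
  rewrite /w1 patchE; case: ifPn => //.
  by rewrite inE /= in_itv/= andbT lee_fin; exact: w0.
have w1E u : 0 < u -> w1 u = (w u)%:E.
  by move=> u0; rewrite /w1 patchE mem_set//= in_itv/= u0.
(* Points outside [J] are sent to 0 by [s], so this value removes them from the integral. *)
have w10 : w1 0 = 0%E by rewrite /w1 patchE memNset//= in_itv/= ltxx.
have sJ x : J x -> s x = psi x by move=> Jx; rewrite /s patchE mem_set.
have rs x : J x -> r (psi x) = x.
  move=> Jx; rewrite /r patchE mem_set ?(inv_on_psi bij)//=.
  by rewrite in_itv/= (psi_gt0 bij Jx).
have toS (Z W : {RV P >-> R}) : {ae P, forall t, J (Z t)} ->
    {ae P, forall t, W t = psi (Z t)} -> {ae P, forall t, W t = s (Z t)}.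
  by move=> ZJ Wpsi; apply: filterS2 ZJ Wpsi => t Jt ->; rewrite sJ.
have toR (Z W : {RV P >-> R}) : {ae P, forall t, J (Z t)} ->
    {ae P, forall t, W t = psi (Z t)} -> {ae P, forall t, Z t = r (W t)}.
  by move=> ZJ Wpsi; apply: filterS2 ZJ Wpsi => t Jt ->; rewrite rs.
have E := integral_relative_density_transform Xf Yg psiXf psiYg ms mr
  (toS _ _ XJ Xpsi) (toR _ _ XJ Xpsi) (toS _ _ YJ Ypsi) (toR _ _ YJ Ypsi)
  beta1 mw1 w1_ge0.
rewrite /gwrigf integral_mkcond [RHS]integral_mkcond.
transitivity (\int[lebesgue_measure]_u
    (w1 u * relative_density beta fpsi gpsi u))%E.
  apply: eq_integral => u _; rewrite /w1 !patchE.
  by case: ifP => _; rewrite ?mul0e.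
rewrite [LHS]E; apply: eq_integral => x _; rewrite patchE.
have [|xJ] := boolP (x \in J).
  by rewrite inE => Jx; rewrite (sJ _ Jx) (w1E _ (psi_gt0 bij Jx)).
by rewrite /s patchE (negbTE xJ) w10 mul0e.
Qed.

Unset Implicit Arguments.

Theorem theorem3p1 (d : measure_display) (T : measurableType d) (R : realType)
    (P : probability T R) (X Y psiX psiY : {RV P >-> R})
    (f g fpsi gpsi : R -> R) (J : set R) (psi : R -> R)
    (w : R -> R) (beta : R)
    (X_ge0 : {ae P, forall t, 0 <= X t})
    (Y_ge0 : {ae P, forall t, 0 <= Y t})
    (Xf : has_density X f) (Yg : has_density Y g)
    (J_open : open J) (J_itv : is_interval J)
    (XJ : {ae P, forall t, J (X t)})
    (YJ : {ae P, forall t, J (Y t)})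
    (psi_bij : set_bij J `]0, +oo[ psi)
    (psi_diff : forall x, J x -> derivable psi x 1)
    (psiXE : {ae P, forall t, psiX t = psi (X t)})
    (psiYE : {ae P, forall t, psiY t = psi (Y t)})
    (psiXf : has_density psiX fpsi) (psiYg : has_density psiY gpsi)
    (w_meas : measurable_fun (`[0, +oo[ : set R) w)
    (w_ge0 : forall x, 0 <= x -> 0 <= w x)
    (beta_ge1 : 1 <= beta) :
  ({in J &, {homo psi : x y / x < y}} ->
     gwrigf w beta fpsi gpsi =
     oriented_integral (inv_at0 J psi) (inv_at_pinfty J psi)
       (fun x => ((w (psi x))%:E * relative_density beta f g x)%E)) /\
  ({in J &, {homo psi : x y /~ x < y}} ->
     gwrigf w beta fpsi gpsi =
     (- oriented_integral (inv_at0 J psi) (inv_at_pinfty J psi)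
          (fun x => ((w (psi x))%:E * relative_density beta f g x)%E))%E).
Proof.
have mJ : measurable J by exact: open_measurable.
have itv0 : is_interval (`]0, +oo[ : set R) by exact: interval_is_interval.
have mw : measurable_fun (`]0, +oo[ : set R) w.
  apply: measurable_funS w_meas; first exact: measurable_itv.
  by apply: subset_itvr; rewrite bnd_simp.
have w0 x : 0 < x -> 0 <= w x by move=> /ltW; exact: w_ge0.
(* The preimage of 1 lies strictly between the endpoints. The strict inequality selects the branch
   of [oriented_integral] in each case. *)
have inf_lt_sup : (ereal_inf (EFin @` J) < ereal_sup (EFin @` J))%E.
  have : J (inv_on J psi 1) by exact: inv_on_mem.
  rewrite -{1}(open_interval_ereal_inf_sup J_open J_itv) /= => /andP[].
  exact: lt_trans.
have transform := gwrigf_transform Xf Yg mJ XJ YJ psi_bij _ _ psiXE psiYE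
  psiXf psiYg mw w0 beta_ge1.
split=> mono.
  have [-> ->] := inv_lim_increasing psi_bij mono.
  rewrite /oriented_integral (ltW inf_lt_sup).
  rewrite (open_interval_ereal_inf_sup J_open J_itv).
  apply: transform.
    apply: measurable_fun_nondecreasing_in => // x y Jx Jy.
    by rewrite le_eqVlt => /predU1P[->//|xy]; rewrite ltW// mono.
  apply: measurable_fun_nondecreasing_in => // x y; rewrite !inE.
  exact: (nondecreasing_inv_on psi_bij).
have [-> ->] := inv_lim_decreasing psi_bij mono.
(* The limits are now in reverse order, so the sign from the orientation cancels the one in the
   statement. *)
rewrite /oriented_integral leNgt inf_lt_sup /= oppeK.
rewrite (open_interval_ereal_inf_sup J_open J_itv).
apply: transform.
  apply: measurable_fun_nonincreasing_in => // x y Jx Jy.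
  by rewrite le_eqVlt => /predU1P[->//|xy]; rewrite ltW// mono.
apply: measurable_fun_nonincreasing_in => // x y; rewrite !inE.
exact: (nonincreasing_inv_on psi_bij).
Qed.
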